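(* Let $B\in\mathbb{C}^{m\times n}$, $\tilde W\in\mathbb{C}^{n\times m}$ and $\tilde k=\mathrm{ind}(B\tilde W)$. If $X\in\mathbb{C}^{m\times n}$ is a minimal rank $W$-weighted weak Drazin inverse of $B$ and $Y=B^{\dagger}B\tilde W X\tilde W$, then: (i) $BY=P_{\mathcal R((B\tilde W)^{\tilde k}),\,\mathcal N(X\tilde W)}$; (ii) $YB=P_{\mathcal R(B^{\dagger}(B\tilde W)^{\tilde k+1}),\,\mathcal N(X\tilde W B)}$; (iii) $Y=B^{(2)}_{\mathcal R(B^{\dagger}(B\tilde W)^{\tilde k+1}),\,\mathcal N(X\tilde W)}$.
   Context: $\mathcal R(\cdot)$ and $\mathcal N(\cdot)$ denote range and null space; $B^{\dagger}$ is the Moore-Penrose inverse. $P_{E,F}$ denotes the (oblique) projection, i.e. the idempotent matrix with range $E$ and null space $F$. $B^{(2)}_{E,F}$ denotes the unique matrix $H\in\mathbb{C}^{n\times m}$ with $HBH=H$, $\mathcal R(H)=E$ and $\mathcal N(H)=F$ (when it exists). For a square complex matrix $T$, $\mathrm{ind}(T)$ is the smallest nonnegative integer $k$ with $\mathrm{rank}(T^k)=\mathrm{rank}(T^{k+1})$ (with $T^0=I$). For $\tilde k=\mathrm{ind}(B\tilde W)$, a matrix $X\in\mathbb{C}^{m\times n}$ is a minimal rank $W$-weighted weak Drazin inverse of $B$ (with respect to the weight $\tilde W$) if $X\tilde W(B\tilde W)^{\tilde k+1}=(B\tilde W)^{\tilde k}$ and $\mathrm{rank}(X)=\mathrm{rank}((B\tilde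 W)^{\tilde k})$. *)

(* Defs.v *)
From mathcomp Require Import all_boot all_order all_algebra.
From mathcomp Require Import spectral.

Set Implicit Arguments.
Unset Strict Implicit.
Unset Printing Implicit Defensive.

Import Order.TTheory GRing.Theory Num.Theory.
Local Open Scope ring_scope.
Local Open Scope sesquilinear_scope.

(* Matrices act on column vectors by left multiplication (MathComp's %MS
   row-space theory uses the opposite convention). *)
Definition range_mx (F : fieldType) m n (A : 'M[F]_(m, n)) : {vspace 'cV[F]_m} :=
  limg (linfun (mulmx A : 'cV[F]_n -> 'cV[F]_m)).

Definition null_mx (F : fieldType) m n (A : 'M[F]_(m, n)) : {vspace 'cV[F]_n} :=
  lker (linfun (mulmx A : 'cV[F]_n -> 'cV[F]_m)).

Lemma range_mxP (F : fieldType) m n (A : 'M[F]_(m, n)) (y : 'cV[F]_m) :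
  reflect (exists x : 'cV[F]_n, y = A *m x) (y \in range_mx A).
Proof.
apply: (iffP memv_imgP) => [[x _ ->]|[x ->]]; exists x;
  by rewrite ?lfunE ?memvf.
Qed.

Lemma null_mxP (F : fieldType) m n (A : 'M[F]_(m, n)) (x : 'cV[F]_n) :
  reflect (A *m x = 0) (x \in null_mx A).
Proof. by rewrite memv_ker lfunE; apply: eqP. Qed.

Lemma index_mx_subproof (F : fieldType) n (T : 'M[F]_n) :
  exists k, \rank (T ^+ k) == \rank (T ^+ k.+1).
Proof.
have leS k : (\rank (T ^+ k.+1) <= \rank (T ^+ k))%N.
  by rewrite exprSr mxrankM_maxl.
have [/existsP[k rk]|/existsPn neq] :=
  boolP [exists k : 'I_n.+1, \rank (T ^+ k) == \rank (T ^+ k.+1)].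
  by exists k.
have bound k : (k <= n.+1)%N -> (\rank (T ^+ k) + k <= n)%N.
  elim: k => [_|k IHk ltk]; first by rewrite addn0 rank_leq_row.
  apply: leq_trans (IHk (ltnW ltk)); rewrite addnS -addSn leq_add2r.
  by rewrite ltn_neqAle eq_sym (neq (Ordinal ltk)) leS.
by have := bound _ (leqnn _); rewrite addnS ltnNge leq_addl.
Qed.

Definition index_mx (F : fieldType) n (T : 'M[F]_n) : nat :=
  ex_minn (index_mx_subproof T).

Section MoorePenrose.
Variable C : numClosedFieldType.

Definition penrose m n (B : 'M[C]_(m, n)) (H : 'M[C]_(n, m)) : bool :=
  [&& B *m H *m B == B, H *m B *m H == H,
      (B *m H)^t* == B *m H & (H *m B)^t* == H *m B].

Let trmxC_mul m n p (A : 'M[C]_(m, n)) (B : 'M[C]_(n, p)) :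
  (A *m B)^t* = B^t* *m A^t*.
Proof. by rewrite trmx_mul map_mxM. Qed.

Let gram_unit r n (G : 'M[C]_(r, n)) : row_free G -> G *m G^t* \in unitmx.
Proof.
move=> Gfree; rewrite -row_free_unit -kermx_eq0 -submx0.
apply/rV_subP => v /sub_kermxP vGG; rewrite submx0.
have vGGv : v *m G *m (v *m G)^t* = 0.
  by rewrite trmxC_mul mulmxA -(mulmxA v) vGG mul0mx.
have /(congr1 (mulmx^~ (pinvmx G))) : v *m G = 0.
  apply/eqP; rewrite -(dnorm_eq0 (@dotmx C n)).
  by apply/eqP; apply: etrans (dotmxE _ _) _; rewrite vGGv mxE.
by rewrite mulmxKp // mul0mx => ->.
Qed.

Let penrose_full_rank m n r (F : 'M[C]_(m, r)) (G : 'M[C]_(r, n)) :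
  row_free G -> row_free (F^t* ) -> exists H, penrose (F *m G) H.
Proof.
move=> Gfree Ffree; pose M := G *m G^t*; pose N := F^t* *m F.
have Mu : M \in unitmx by rewrite gram_unit.
have Nu : N \in unitmx by have := gram_unit Ffree; rewrite trmxCK.
have Mt : M^t* = M by rewrite trmxC_mul trmxCK.
have Nt : N^t* = N by rewrite trmxC_mul trmxCK.
have invt (A : 'M[C]_r) : (invmx A)^t* = invmx (A^t* ).
  by rewrite trmx_inv map_invmx.
pose H := G^t* *m invmx M *m invmx N *m F^t*.
have BH : F *m G *m H = F *m invmx N *m F^t*.
  rewrite /H !mulmxA -(mulmxA F G) -/M.
  by rewrite -(mulmxA F M) mulmxV // mulmx1.
have HB : H *m (F *m G) = G^t* *m invmx M *m G.
  rewrite /H !mulmxA -(mulmxA _ (F^t* ) F) -/N.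
  by rewrite -(mulmxA _ (invmx N) N) mulVmx // mulmx1.
exists H; apply/and4P; split; apply/eqP.
- rewrite BH !mulmxA -(mulmxA _ (F^t* ) F) -/N.
  by rewrite -(mulmxA F (invmx N)) mulVmx // mulmx1.
- rewrite HB /H !mulmxA -(mulmxA _ G (G^t* )) -/M.
  by rewrite -(mulmxA (G^t* ) (invmx M) M) mulVmx // mulmx1.
- by rewrite BH !trmxC_mul invt Nt trmxCK mulmxA.
- by rewrite HB !trmxC_mul invt Mt trmxCK mulmxA.
Qed.

Lemma penrose_exists m n (B : 'M[C]_(m, n)) : exists H, penrose B H.
Proof.
rewrite -(mulmx_base B); apply: penrose_full_rank (row_base_free B) _.
by rewrite /row_free mxrank_map mxrank_tr; apply: col_base_full.
Qed.

Lemma penrose_unique m n (B : 'M[C]_(m, n)) H K :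
  penrose B H -> penrose B K -> H = K.
Proof.
move=> /and4P[/eqP BHB /eqP HBH /eqP BHt /eqP HBt].
move=> /and4P[/eqP BKB /eqP KBK /eqP BKt /eqP KBt].
have BHBK : B *m H = B *m K.
  by rewrite -BHt -{1}BKB -(mulmxA (B *m K)) trmxC_mul BHt BKt mulmxA BHB.
have HBKB : H *m B = K *m B.
  rewrite -HBt -{1}BKB -(mulmxA B) mulmxA trmxC_mul HBt KBt.
  by rewrite -mulmxA (mulmxA B H B) BHB.
by rewrite -HBH HBKB -mulmxA BHBK mulmxA KBK.
Qed.

Definition mpinv m n (B : 'M[C]_(m, n)) : 'M[C]_(n, m) :=
  xchoose (penrose_exists B).

Lemma mpinvP m n (B : 'M[C]_(m, n)) : penrose B (mpinv B).
Proof. exact: xchooseP. Qed.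

End MoorePenrose.

Section WeightedWeakDrazin.
Variable F : fieldType.

(* P = P_{E,V}; [unique] makes this the equality of P with the matrix denoted
   by P_{E,V}, including that this matrix is well defined. *)
Definition is_projection m (E V : {vspace 'cV[F]_m}) (P : 'M[F]_m) : Prop :=
  unique (fun Q : 'M[F]_m =>
    [/\ Q *m Q = Q, range_mx Q = E & null_mx Q = V]) P.

(* Y = B^{(2)}_{E,V}, in the same sense. *)
Definition is_outer_inverse m n (B : 'M[F]_(m, n))
    (E : {vspace 'cV[F]_n}) (V : {vspace 'cV[F]_m}) (Y : 'M[F]_(n, m)) : Prop :=
  unique (fun H : 'M[F]_(n, m) =>
    [/\ H *m B *m H = H, range_mx H = E & null_mx H = V]) Y.

Definition min_rank_wdrazin m n (B : 'M[F]_(m, n)) (W : 'M[F]_(n, m))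
    (X : 'M[F]_(m, n)) : Prop :=
  let k := index_mx (B *m W) in
  X *m W *m (B *m W) ^+ k.+1 = (B *m W) ^+ k /\
  \rank X = \rank ((B *m W) ^+ k).

End WeightedWeakDrazin.

(* Main.v *)
Require Import Defs.
From mathcomp Require Import all_boot all_order all_algebra.
From mathcomp Require Import reals complex.

Import Order.TTheory GRing.Theory Num.Theory.
Local Open Scope ring_scope.

(** Put T = BW and Z = XW. From Z T^(k+1) = T^k and rank X = rank T^k one gets
  R(Z) = R(T^k) = R(T^(k+1)), and Z T acts as the identity on R(T^k), so
  Z T Z = Z. Since B Y = T Z and Y = B^+ T Z, the three claims reduce to
  comparing ranges and null spaces of products that are left or right multiples
  of one another. *)

(** Each column of [A] is [A] applied to a basis vector; after transposition this becomes a
    row-space inclusion, which [submxP] factors. *)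
Lemma range_mx_subP (F : fieldType) m n p (A : 'M[F]_(m, n)) (B : 'M_(m, p)) :
  reflect (exists M, A = B *m M) (range_mx A <= range_mx B)%VS.
Proof.
apply: (iffP subvP) => [sAB | [M ->] _ /range_mxP[x ->]]; last first.
  by apply/range_mxP; exists (M *m x); rewrite mulmxA.
suff /submxP[M /(congr1 trmx)] : (A^T <= B^T)%MS.
  by rewrite trmx_mul !trmxK; exists M^T.
apply/row_subP => j; rewrite -tr_col.
have /sAB/range_mxP[x ->] : col j A \in range_mx A.
  by apply/range_mxP; exists (delta_mx j 0); rewrite colE.
by rewrite trmx_mul submxMl.
Qed.

Lemma null_mx_mul0 {F : fieldType} {m n p q} {A : 'M[F]_(m, n)} {B : 'M_(p, n)}
    (D : 'M_(n, q)) :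
  (null_mx A <= null_mx B)%VS -> A *m D = 0 -> B *m D = 0.
Proof.
move=> /subvP sAB AD0; apply/matrixP => i j; rewrite [RHS]mxE.
have /sAB/null_mxP/matrixP/(_ i 0) : col j D \in null_mx A.
  by apply/null_mxP; rewrite colE mulmxA AD0 mul0mx.
by rewrite colE mulmxA -colE !mxE.
Qed.

Lemma eq_range_mx (F : fieldType) m n p (A : 'M[F]_(m, n)) (B : 'M_(m, p)) M N :
  A = B *m M -> B = A *m N -> range_mx A = range_mx B.
Proof.
move=> AB BA; apply/eqP; rewrite eqEsubv.
by apply/andP; split; apply/range_mx_subP; [exists M | exists N].
Qed.

Lemma eq_null_mx (F : fieldType) m n p (A : 'M[F]_(m, n)) (B : 'M_(p, n)) M N :
  A = M *m B -> B = N *m A -> null_mx A = null_mx B.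
Proof.
move=> AB BA; apply/vspaceP => x.
by apply/null_mxP/null_mxP => x0; rewrite (AB, BA) -mulmxA x0 mulmx0.
Qed.

(** The column space of [B *m M] lies in that of [B], so equal ranks force the two to coincide. *)
Lemma rank_right_factor (F : fieldType) m n p (B : 'M[F]_(m, n))
    (M : 'M_(n, p)) :
  \rank (B *m M) = \rank B -> exists N, B = B *m M *m N.
Proof.
move=> rBM; have sBM : ((B *m M)^T <= B^T)%MS by rewrite trmx_mul submxMl.
have := mxrank_leqif_sup sBM; rewrite !mxrank_tr rBM => -[_].
rewrite eqxx => /esym/submxP[N /(congr1 trmx)].
by rewrite trmx_mul !trmxK => BE; exists N^T.
Qed.

(** Uniqueness: the columns of [1 - B *m H] lie in the common null space, so [K = K *m B *m H]; the
    common range gives [H = K *m M], whence [K *m B *m H = H]. *)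
Lemma outer_inverse_of_eq (F : fieldType) m n (B : 'M[F]_(m, n)) H :
  H *m B *m H = H -> is_outer_inverse B (range_mx H) (null_mx H) H.
Proof.
move=> HBH; split=> // K [KBK rK nK].
have /range_mx_subP[M HE] : (range_mx H <= range_mx K)%VS by rewrite rK.
have sHK : (null_mx H <= null_mx K)%VS by rewrite nK.
have KE : K = K *m (B *m H).
  apply/eqP; rewrite -subr_eq0 -{1}(mulmx1 K) -mulmxBr; apply/eqP.
  by apply: null_mx_mul0 _ sHK _; rewrite mulmxBr mulmx1 mulmxA HBH subrr.
by rewrite KE HE !mulmxA KBK.
Qed.

(** An idempotent is an outer inverse of the identity matrix. *)
Lemma projection_of_idem (F : fieldType) m (P : 'M[F]_m) :
  P *m P = P -> is_projection (range_mx P) (null_mx P) P.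
Proof.
move=> PP; have [|_ uP] := outer_inverse_of_eq _ _ _ 1%:M P; first by rewrite mulmx1.
by split=> // Q [QQ rQ nQ]; apply: uP; split; rewrite ?mulmx1.
Qed.

Theorem lemma3p6 (R : realType) (m n : nat)
    (B : 'M[R[i]]_(m, n)) (W : 'M[R[i]]_(n, m)) (X : 'M[R[i]]_(m, n)) :
  min_rank_wdrazin B W X ->
  let k := index_mx (B *m W) in
  let Y := mpinv B *m B *m W *m X *m W in
  [/\ is_projection (range_mx ((B *m W) ^+ k)) (null_mx (X *m W)) (B *m Y),
      is_projection (range_mx (mpinv B *m (B *m W) ^+ k.+1))
                    (null_mx (X *m W *m B)) (Y *m B)
    & is_outer_inverse B (range_mx (mpinv B *m (B *m W) ^+ k.+1))
                       (null_mx (X *m W)) Y].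
Proof.
move=> [] /=; set k := index_mx _ => ZT rX; set Y := _ *m _ *m X *m W.
have XE : X *m (W *m (B *m W) ^+ k.+1) = (B *m W) ^+ k by rewrite mulmxA.
have YE : Y = mpinv B *m (B *m W) *m (X *m W) by rewrite !mulmxA.
have /and4P[/eqP BHB _ _ _] := mpinvP B.
have BY : B *m Y = B *m W *m (X *m W) by rewrite YE !mulmxA BHB.
(* By [XE], [(B *m W) ^+ k] is a right multiple of [X], and it has the rank of [X]. *)
have [N XN] : exists N, X = (B *m W) ^+ k *m N.
  by rewrite -XE; apply: rank_right_factor; rewrite XE.
have ZE : X *m W = (B *m W) ^+ k *m (N *m W) by rewrite {1}XN mulmxA.
clearbody k Y; clear BHB XE XN rX.
move: (B *m W) (X *m W) ZT YE BY ZE => T Z ZT YE BY ZE.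
have TS : T ^+ k.+1 = T *m T ^+ k by rewrite exprS.
have TSr : T ^+ k.+1 = T ^+ k *m T by rewrite exprSr.
(* The identity [ZT] bounds the rank of [T ^+ k] by that of [T ^+ k.+1]. *)
have [S TE] : exists S, T ^+ k = T ^+ k.+1 *m S.
  rewrite TSr; apply: rank_right_factor; apply/eqP; rewrite -TSr eqn_leq.
  by rewrite -{2}ZT mxrankM_maxr TSr mxrankM_maxl.
(* [Z] factors through [T ^+ k] on the left, and [Z *m T] fixes [T ^+ k] by [ZT]. *)
have ZTZ : Z *m T *m Z = Z.
  by rewrite {2}ZE !mulmxA -(mulmxA Z T) -TS ZT -mulmxA -ZE.
have YBY : Y *m B *m Y = Y by rewrite -mulmxA BY {1}YE -(mulmxA _ Z) (mulmxA Z) ZTZ YE.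
have TZr : T *m Z = T ^+ k.+1 *m (N *m W) by rewrite ZE mulmxA -TS.
have TZl : T ^+ k.+1 = T *m Z *m T ^+ k.+1 by rewrite -mulmxA ZT TS.
have rTZ : range_mx (T *m Z) = range_mx (T ^+ k).
  apply: (@eq_range_mx _ _ _ _ _ _ (T *m (N *m W)) (T ^+ k.+1 *m S)).
    by rewrite TZr TSr !mulmxA.
  by rewrite mulmxA -TZl.
have rY : range_mx Y = range_mx (mpinv B *m T ^+ k.+1).
  apply: (@eq_range_mx _ _ _ _ _ _ (N *m W) (T ^+ k.+1)).
    by rewrite YE -!mulmxA TZr !mulmxA.
  by rewrite {1}TZl YE !mulmxA.
(* [Z] is recovered from [Y] as [Z *m B *m Y = Z *m T *m Z]. *)
have nY : null_mx Y = null_mx Z.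
  by apply: (@eq_null_mx _ _ _ _ _ _ _ (Z *m B) YE); rewrite -mulmxA BY mulmxA.
split.
- rewrite -rTZ BY.
  have <- : null_mx (T *m Z) = null_mx Z.
    by apply: (@eq_null_mx _ _ _ _ _ _ T Z); rewrite ?mulmxA ?ZTZ.
  by apply: projection_of_idem; rewrite -(mulmxA T) (mulmxA Z) ZTZ.
- rewrite -rY.
  have <- : range_mx (Y *m B) = range_mx Y by apply: eq_range_mx (esym YBY).
  (* The same multiplier [Z *m B] takes [Y *m B] back to [Z *m B]. *)
  have <- : null_mx (Y *m B) = null_mx (Z *m B).
    apply: (@eq_null_mx _ _ _ _ _ _ (mpinv B *m T) (Z *m B)).
      by rewrite YE !mulmxA.
    by rewrite -mulmxA (mulmxA B) BY !mulmxA ZTZ.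
  by apply: projection_of_idem; rewrite mulmxA YBY.
- by rewrite -rY -nY; apply: outer_inverse_of_eq.
Qed.
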